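(* Let $\alpha$ be a countable ordinal. Then $Q_{\alpha}:= I_{<\omega}(S_{\alpha})$ is the least join-subsemilattice of $[\omega]^{<\omega}$ which belongs to $\mathbb{J}_{\alpha}$; that is, $I_{<\omega}(S_{\alpha})$ is isomorphic to a join-subsemilattice of $[\omega]^{<\omega}$, it belongs to $\mathbb{J}_{\alpha}$, and it embeds as a join-semilattice in every join-subsemilattice of $[\omega]^{<\omega}$ which belongs to $\mathbb{J}_{\alpha}$.
   Context: $\mathbb{J}$ is the class of join-semilattices having a least element. An ideal of a poset $P$ is a non-empty up-directed initial segment (down-closed subset); $J(P)$ is the set of ideals of $P$ ordered by inclusion. $I(\alpha)$ is the order type of the chain of all initial segments (including the empty one and the whole chain), ordered by inclusion, of a chain of type $\alpha$. $\mathbb{J}_{\alpha}$ is the class of $P\in\mathbb{J}$ such that $J(P)$ contains a chain of type $I(\alpha)$. A join-subsemilattice is a subset closed under binary joins, with the induced order; $P$ embeds as a join-semilattice in $P'$ if $P$ is isomorphic to a join-subsemilattice of $P'$. $[\omega]^{<\omega}$ is the set of finite subsets of $\omega$ ordered by inclusion. For a poset $S$, $I_{<\omega}(S)$ is the set of finitely generated initial segments of $S$ (including $\emptyset$), ordered by inclusion. The poset $S_\alpha$ is defined as follows. If $\alpha<\omega$, $S_{\alpha}:=\alpha$ (the $\alpha$-element chain). If $\alpha=\omega\alpha'+n$ with $\alpha'\neq 0$ and $n<\omega$, then $S_{\alpha}:=\Omega(\alpha')\oplus n$, the direct sum (disjoint union with no comparabilities between the two parts) of $\Omega(\alpha')$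 and the $n$-element chain. Here $\omega\alpha'$ is the lexicographic sum of $\alpha'$ copies $\omega\cdot\{\beta\}$ ($\beta\in\alpha'$) of the chain $\omega$, and $\Omega(\alpha')$ is a poset obtained as follows: take a bijection $\psi:\omega\alpha'\to\omega$ which is order-preserving on each component $\omega\cdot\{\beta\}$, and order $\omega\alpha'$ by letting $x\leq y$ iff $x\leq y$ in the chain $\omega\alpha'$ and $\psi(x)\leq\psi(y)$ in $\omega$. (Any such $\psi$ may be used; the resulting posets all embed in each other.) *)

(* Defs.v *)
From HB Require Import structures.
From mathcomp Require Import all_boot all_order.
From mathcomp Require Import finmap all_classical.
Set Implicit Arguments.
Unset Strict Implicit.
Unset Printing Implicit Defensive.
Import Order.TTheory.
Local Open Scope classical_set_scope.
Local Open Scope order_scope.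

(* A subset A of a poset, viewed as the type set_type A, carries the induced
   order.  With the inclusion order of set T, this makes every set of subsets
   of T a poset ordered by inclusion. *)
HB.instance Definition _ (d : Order.disp_t) (T : porderType d) (A : set T) :=
  SubChoice.copy (set_type A) {x | x \in A}.
HB.instance Definition _ (d : Order.disp_t) (T : porderType d) (A : set T) :=
  [SubChoice_isSubPOrder of (set_type A) by <: with d].
HB.instance Definition _ (d : Order.disp_t) (T : orderType d) (A : set T) :=
  [SubChoice_isSubOrder of (set_type A) by <: with d].

Section Comparison.
Context {d d' : Order.disp_t} (P : porderType d) (P' : porderType d').

Definition isomorphic : Prop :=
  exists f : P -> P', bijective f /\ {mono f : x y / x <= y}.

Definition order_embeds : Prop :=
  exists f : P -> P', {mono f : x y / x <= y}.

End Comparison.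

Section Subsets.
Context {d : Order.disp_t} (P : porderType d).

Definition initial (X : set P) : Prop := forall x y, X y -> x <= y -> X x.

Definition updirected (X : set P) : Prop :=
  forall x y, X x -> X y -> exists z, [/\ X z, x <= z & y <= z].

(* Every join, taken in P, of two elements of A lies in A. *)
Definition join_closed (A : set P) : Prop :=
  forall x y z, A x -> A y -> supremums [set x; y] z -> A z.

(* I(P) *)
Definition initials : set (set P) := [set X | initial X].

(* J(P) *)
Definition ideals : set (set P) :=
  [set X | [/\ X !=set0, updirected X & initial X]].

(* I_{<omega}(P) *)
Definition fg_initials : set (set P) :=
  [set X | exists2 F, finite_set F & X = [set x | exists2 y, F y & x <= y]].

(* The class J *)
Definition bounded_join_semilattice : Prop :=
  (forall x y : P, supremums [set x; y] !=set0) /\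
  (exists b : P, forall x, b <= x).

End Subsets.
Arguments initials {d} P _.
Arguments ideals {d} P _.
Arguments fg_initials {d} P _.

(* P is isomorphic to a join-subsemilattice of P' *)
Definition join_embeds {d d' : Order.disp_t} (P : porderType d)
    (P' : porderType d') : Prop :=
  exists A : set P', join_closed A /\ isomorphic P A.

(* The class J_alpha *)
Definition in_J {d d' : Order.disp_t} (alpha : orderType d)
    (P : porderType d') : Prop :=
  bounded_join_semilattice P /\ order_embeds (initials alpha) (ideals P).

Definition fin_subsets (T : Type) : set (set T) := [set X | finite_set X].
Arguments fin_subsets : clear implicits.

(* Ordinals are represented by well-ordered types, up to isomorphism. *)
Definition is_ordinal {d : Order.disp_t} (alpha : orderType d) : Prop :=
  well_founded (<%O : rel alpha).

Section Sums.
Context (d d' : Order.disp_t) (X : porderType d) (Y : porderType d').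

(* Ordinal sum: X followed by Y. *)
Definition ord_sum : Type := (X + Y)%type.
HB.instance Definition _ := Choice.on ord_sum.

Definition ord_sum_le (u v : ord_sum) : bool :=
  match u, v with
  | inl x, inl x' => x <= x'
  | inr y, inr y' => y <= y'
  | inl _, inr _ => true
  | inr _, inl _ => false
  end.

Fact ord_sum_refl : reflexive ord_sum_le.
Proof. by case=> x /=. Qed.

Fact ord_sum_anti : antisymmetric ord_sum_le.
Proof. by case=> [x|x] [y|y] //= /le_anti ->. Qed.

Fact ord_sum_trans : transitive ord_sum_le.
Proof. by case=> [y|y] [x|x] [z|z] //=; apply: le_trans. Qed.

HB.instance Definition _ := Order.Le_isPOrder.Build d ord_sum
  ord_sum_refl ord_sum_anti ord_sum_trans.

(* Direct sum: no comparabilities between X and Y. *)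
Definition direct_sum : Type := (X + Y)%type.
HB.instance Definition _ := Choice.on direct_sum.

Definition direct_sum_le (u v : direct_sum) : bool :=
  match u, v with
  | inl x, inl x' => x <= x'
  | inr y, inr y' => y <= y'
  | _, _ => false
  end.

Fact direct_sum_refl : reflexive direct_sum_le.
Proof. by case=> x /=. Qed.

Fact direct_sum_anti : antisymmetric direct_sum_le.
Proof. by case=> [x|x] [y|y] //= /le_anti ->. Qed.

Fact direct_sum_trans : transitive direct_sum_le.
Proof. by case=> [y|y] [x|x] [z|z] //=; apply: le_trans. Qed.

HB.instance Definition _ := Order.Le_isPOrder.Build d direct_sum
  direct_sum_refl direct_sum_anti direct_sum_trans.

End Sums.

Section Omega.
Context (d : Order.disp_t) (B : orderType d).

(* The chain omega . B: (b, k) is the k-th element of the copy omega . {b}. *)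
Definition omega_times : Type := B *lexi[d] nat.
HB.instance Definition _ := Order.Total.on omega_times.

Definition admissible (psi : omega_times -> nat) : Prop :=
  bijective psi /\ forall b : B, {homo (fun k => psi (b, k)) : m n / m <= n}.

Definition Omega (psi : omega_times -> nat) : Type := omega_times.

Context (psi : omega_times -> nat).
HB.instance Definition _ := Choice.on (Omega psi).

Definition Omega_le (x y : Omega psi) : bool :=
  ((x : omega_times) <= y) && (psi x <= psi y).

Fact Omega_refl : reflexive Omega_le.
Proof. by move=> x; rewrite /Omega_le !lexx. Qed.

Fact Omega_anti : antisymmetric Omega_le.
Proof.
by move=> x y /andP[/andP[xy _] /andP[yx _]]; apply: le_anti; rewrite xy yx.
Qed.

Fact Omega_trans : transitive Omega_le.
Proof.
move=> y x z /andP[xy pxy] /andP[yz pyz].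
by rewrite /Omega_le (le_trans xy yz) (le_trans pxy pyz).
Qed.

HB.instance Definition _ := Order.Le_isPOrder.Build d (Omega psi)
  Omega_refl Omega_anti Omega_trans.

End Omega.

(* S is (a copy of) S_alpha, for some admissible choice of psi; in the infinite
   case alpha = omega alpha' + n. *)
Definition is_S {d d' : Order.disp_t} (alpha : orderType d)
    (S : porderType d') : Prop :=
  (finite_set [set: alpha] /\ isomorphic S alpha) \/
  exists (d1 : Order.disp_t) (alpha' : orderType d1) (n : nat)
      (psi : omega_times alpha' -> nat),
    [/\ is_ordinal alpha', [set: alpha'] !=set0,
        isomorphic alpha (ord_sum (omega_times alpha') 'I_n),
        admissible psi &
        isomorphic S (direct_sum (Omega psi) 'I_n)].

(* Every countable ordinal alpha has an S_alpha: alpha is decomposed as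
   omega alpha' + n by grouping elements at finite distance (lam a is the least
   element of the group of a, and k a the rank of a in it). *)
Module ExistenceOfS.

Lemma omega_times_le (d : Order.disp_t) (B : orderType d) (x y : omega_times B) :
  (x <= y) = (x.1 < y.1) || (x.1 == y.1) && (x.2 <= y.2)%N.
Proof.
rewrite (_ : (x <= y) = (x.1 <= y.1) && ((x.1 >= y.1) ==> (x.2 <= y.2)%N)) //.
by case: ltgtP.
Qed.

Lemma inj_surj_bij (T U : Type) (f : T -> U) :
  injective f -> (forall y, exists x, f x = y) -> bijective f.
Proof.
by move=> fi /choice[g gK]; exists g => // x; apply: fi; rewrite gK.
Qed.

Lemma exists_min (d : Order.disp_t) (alpha : orderType d) (P : alpha -> Prop) :
  is_ordinal alpha -> (exists x, P x) ->
  exists x, P x /\ forall y, P y -> x <= y.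
Proof.
move=> wf [x]; elim/(well_founded_ind wf): x => x IH Px.
have [/existsNP[y /not_implyP[Py /negP]]|H] := pselect (~ forall y, P y -> x <= y).
  by rewrite -ltNge => /IH; exact.
by exists x; split=> //; apply: contrapT.
Qed.

Lemma admissible_exists (d : Order.disp_t) (B : orderType d) :
  countable [set: B] -> [set: B] !=set0 ->
  exists psi : omega_times B -> nat, admissible psi.
Proof.
move=> /countable_injP [c cinj] [b0 _].
pose p (x : omega_times B) := (2 ^ c x.1 * (x.2.*2).+1)%N.
have pinj : injective p.
  move=> [b k] [b' k'] /= e.
  have eb : c b = c b'.
    have := congr1 (logn 2) e; rewrite /p /= !lognM ?expn_gt0 // !pfactorK //.
    by rewrite !logn_coprime ?coprime2n /= ?odd_double // !addn0.
  move: e; rewrite /p /= eb => /eqP; rewrite eqn_pmul2l ?expn_gt0 //.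
  rewrite eqSS => /eqP /double_inj ->.
  by rewrite (cinj b b') ?inE.
pose D m := `[< exists x, p x = m >].
have pD x : D (p x) by apply/asboolP; exists x.
pose rk m := count D (iota 0 m).
have rkS m : rk m.+1 = (rk m + D m)%N.
  by rewrite /rk -addn1 iotaD count_cat /= addn0.
have rkle m m' : (m <= m')%N -> (rk m <= rk m')%N.
  by move=> /subnK <-; rewrite /rk addnC iotaD count_cat leq_addr.
have rklt x m : (p x < m)%N -> (rk (p x) < rk m)%N.
  by move=> /rkle; apply: leq_trans; rewrite rkS pD addn1.
have plt b k k' : (k < k')%N -> (p (b, k) < p (b, k'))%N.
  by move=> kk; rewrite /p ltn_pmul2l ?expn_gt0 // ltnS ltn_double.
exists (rk \o p); split.
  apply: inj_surj_bij.
    move=> x y /= e; apply: pinj.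
    by case: (ltngtP (p x) (p y)) => // /rklt; rewrite e ltnn.
  move=> j.
  have unb : exists m, (j < rk m)%N.
    exists (p (b0, j)).+1.
    have: forall i, (i < rk (p (b0, i)).+1)%N.
      elim=> [|i IH]; first by rewrite rkS pD addn1.
      rewrite rkS pD addn1 ltnS; apply: leq_trans IH _.
      by apply: rkle; exact: plt.
    exact.
  case: (ex_minnP unb) => -[|m]; first by rewrite /rk.
  move=> jm /(_ m); rewrite ltnn => Hm.
  have jm' : (rk m <= j)%N by rewrite leqNgt; apply/negP => /Hm.
  move: jm; rewrite rkS; case Dm: (D m) => /=; last first.
    by rewrite addn0 ltnNge jm'.
  rewrite addn1 ltnS => jm; move/asboolP: Dm => [x pm].
  by exists x => //=; rewrite pm; apply/eqP; rewrite eqn_leq jm jm'.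
move=> b k k'; rewrite leEnat leq_eqVlt => /orP[/eqP-> //|/(plt b) /ltnW].
exact: rkle.
Qed.

Section Decomposition.
Context (d : Order.disp_t) (alpha : orderType d).
Hypothesis wf : is_ordinal alpha.

Let itv (a b : alpha) : set alpha := [set c | a <= c /\ c < b].

Lemma itvU a b c : itv a c `<=` itv a b `|` itv b c.
Proof.
by move=> x [ax xc]; have [xb|bx] := ltP x b; [left|right].
Qed.

Lemma lam_exists a : exists l,
  (l <= a /\ finite_set (itv l a)) /\
  forall y, y <= a /\ finite_set (itv y a) -> l <= y.
Proof.
apply: (exists_min wf); exists a; split=> //.
suff -> : itv a a = set0 by [].
by rewrite -subset0 => x [] /le_lt_trans/[apply]; rewrite ltxx.
Qed.

Let lam a := projT1 (cid (lam_exists a)).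

Lemma lam_le a : lam a <= a. Proof. by rewrite /lam; case: cid => l [[]]. Qed.
Lemma lam_fin a : finite_set (itv (lam a) a).
Proof. by rewrite /lam; case: cid => l [[]]. Qed.
Lemma lam_min a y : y <= a -> finite_set (itv y a) -> lam a <= y.
Proof. by rewrite /lam; case: cid => l [_ H] /= *; apply: H. Qed.

Lemma lam_eq a b : a <= b -> finite_set (itv a b) -> lam a = lam b.
Proof.
move=> ab fab; apply: le_anti; apply/andP; split; last first.
  apply: lam_min (le_trans (lam_le a) ab) _.
  by apply: sub_finite_set (@itvU _ a _) _; rewrite finite_setU; split=> //; apply: lam_fin.
have lba : lam b <= a by exact: lam_min.
apply: lam_min => //; apply: sub_finite_set (lam_fin b).
by move=> x [? xa]; split=> //; apply: lt_le_trans ab.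
Qed.

Lemma lam_lam a : lam (lam a) = lam a.
Proof. exact: lam_eq (lam_le a) (lam_fin a). Qed.

Lemma lam_itv a b : lam a = lam b -> a <= b -> finite_set (itv a b).
Proof.
move=> e ab; apply: sub_finite_set (lam_fin b); rewrite -e => x [ax xb].
by split=> //; apply: le_trans (lam_le a) ax.
Qed.

Lemma lam_mono a b : a <= b -> lam a <= lam b.
Proof.
move=> ab; have [lba|/ltW] := leP (lam b) a; last exact: le_trans (lam_le a).
rewrite -(lam_lam b) (@lam_eq (lam b) a) //.
apply: sub_finite_set (lam_fin b) => x [? xa].
by split=> //; apply: lt_le_trans ab.
Qed.

Let k a := #|` fset_set (itv (lam a) a)|.

Lemma k_lt a b : lam a = lam b -> a < b -> (k a < k b)%N.
Proof.
move=> e ab; rewrite /k -e; apply: fproper_ltn_card.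
rewrite fproperE; apply/andP; split.
  rewrite -fset_set_sub; [|exact: lam_fin|by rewrite e; exact: lam_fin].
  by move=> x [? xa]; split=> //; apply: lt_trans ab.
have fb : finite_set (itv (lam a) b) by rewrite e; exact: lam_fin.
apply/fsubsetPn; exists a.
  by rewrite in_fset_set // inE; split=> //; exact: lam_le.
rewrite in_fset_set; last exact: lam_fin.
by apply/negP; rewrite inE => -[_]; rewrite ltxx.
Qed.

Lemma k_pred a j : k a = j.+1 -> exists b, lam b = lam a /\ k b = j.
Proof.
move=> ka; have fa := lam_fin a.
have [x0 x0P] : exists x, itv (lam a) a x.
  apply/set0P/negP => /eqP e; move: ka; rewrite /k e fset_set0 cardfs0 //.
pose P c := itv (lam a) a c.
have [b [[lb ba] bmax]] : exists b, P b /\ forall c, P c -> c <= b.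
  pose s := fset_set (itv (lam a) a).
  have sP c : (c \in s) <-> P c by rewrite in_fset_set // inE.
  exists (\big[Order.max/x0]_(c <- s) c); split.
    rewrite big_seq; elim/big_ind: _ => [//|u v Pu Pv|c cs]; last exact: (sP c).1.
    by rewrite /Order.max; case: ifP.
  by move=> c Pc; apply: (@bigmax_sup_seq _ _ _ _ _ c) => //; exact: (sP c).2.
exists b.
have eb : lam b = lam a.
  rewrite -(lam_lam a); apply/esym/lam_eq => //.
  by apply: sub_finite_set fa => x [? xb]; split=> //; apply: lt_trans ba.
split=> //; apply: succn_inj; rewrite -ka /k eb.
have -> : itv (lam a) a = b |` itv (lam a) b.
  rewrite predeqE => x; split=> [xP|[->//|[? xb]]].
    have := bmax _ xP; rewrite le_eqVlt => /orP[/eqP->|xb]; first by left.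
    by right; split=> //; case: xP.
  by split=> //; apply: lt_trans ba.
have fb : finite_set (itv (lam a) b) by rewrite -eb; exact: lam_fin.
rewrite fset_setU1 // cardfsU1 in_fset_set // memNset ?add1n //.
by move=> [_]; rewrite ltxx.
Qed.

Lemma k_down a j : (j <= k a)%N -> exists b, lam b = lam a /\ k b = j.
Proof.
move=> /subnK; move: (k a - j)%N => m; elim: m a => [|m IH] a.
  by rewrite add0n => ->; exists a.
rewrite addSn => /esym /k_pred[b [<- kb]]; apply: IH.
by rewrite kb.
Qed.

(* Components with a missing index are final. *)
Lemma fin_top l m b : lam l = l -> (forall a, lam a = l -> k a <> m) ->
  l < b -> lam b = l.
Proof.
move=> ll lm lb; apply: contrapT => nb.
have lbl : l < lam b.
  rewrite lt_neqAle; apply/andP; split; first by apply/eqP => e; apply: nb.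
  by rewrite -[X in X <= _]ll; apply: lam_mono; exact: ltW.
have [c [[lc nc] cmin]] := exists_min wf (ex_intro (fun c => l < c /\ lam c <> l) b (conj lb nb)).
apply: nc; rewrite -[RHS]ll; apply/esym/(lam_eq (ltW lc)).
have kb a : itv l c a -> lam a = l.
  move=> [la ac]; apply: contrapT => na.
  have : c <= a.
    apply: cmin; split=> //; rewrite lt_neqAle la andbT; apply/eqP => e.
    by apply: na; rewrite -e.
  by rewrite leNgt ac.
have km a : lam a = l -> (k a < m)%N.
  move=> la; rewrite ltnNge; apply/negP => /k_down[a' [e km]].
  by apply: (lm a') km; rewrite e.
have kinj : {in itv l c &, injective k}.
  move=> x y; rewrite !inE => /kb ex /kb ey e.
  case: (ltgtP x y) => // xy; [have := @k_lt x y | have := @k_lt y x];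
    by rewrite ex ey e ltnn => /(_ erefl xy).
have : finite_set (k @` itv l c).
  apply: sub_finite_set (finite_II m) => _ [x /kb/km ? <-] //.
by rewrite (eq_finite_set (inj_card_eq kinj)).
Qed.

Lemma is_S_exists : countable [set: alpha] ->
  exists (d' : Order.disp_t) (S : porderType d'), is_S alpha S.
Proof.
move=> cnt.
have [fin|inf] := pselect (finite_set [set: alpha]).
  exists d, alpha; left; split=> //; exists id; split=> //.
  by exists id.
pose full : set alpha := [set l | lam l = l /\ forall m, exists a, lam a = l /\ k a = m].
have [n [n0 nP]] : exists n, ((0 < n)%N -> exists l, lam l = l /\ ~ full l) /\
  forall l, lam l = l -> ~ full l ->
    forall m, (exists a, lam a = l /\ k a = m) <-> (m < n)%N.
  have [[l [ll nl]]|H] := pselect (exists l, lam l = l /\ ~ full l); last first.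
    by exists 0%N; split=> // l ll nl; exfalso; apply: H; exists l.
  have ex : exists m, `[< forall a, lam a = l -> k a <> m >].
    apply: contrapT => H; apply: nl; split=> // m; apply: contrapT => Hm.
    apply: H; exists m; apply/asboolP => a la ka; apply: Hm; by exists a.
  case: (ex_minnP ex) => n /asboolP nn nmin; exists n; split; first by exists l.
  move=> l' ll' nl' m.
  have top l1 l2 : lam l1 = l1 -> ~ full l1 -> lam l2 = l2 -> l1 < l2 -> False.
    move=> e1 n1 e2 l12; apply: n1; split=> // i; apply: contrapT => H.
    have := @fin_top l1 i l2 e1 _ l12; rewrite e2 => e.
    move: l12; rewrite e ?ltxx // => a la ka; apply: H; by exists a.
  have {nl' ll'} -> : l' = l.
    by case: (ltgtP l' l) => // lt; exfalso; [exact: top lt|exact: top lt].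
  split=> [[a [la ka]]|mn].
    rewrite ltnNge -ka; apply/negP => /k_down[b [lb kb]].
    by apply: (nn b) => //; rewrite lb.
  apply: contrapT => H; suff : (n <= m)%N by rewrite leqNgt mn.
  by apply: nmin; apply/asboolP => a la ka; apply: H; exists a.
have lam_full_lt a b : full (lam a) -> ~ full (lam b) -> lam a < lam b.
  move=> fa nb; rewrite ltNge le_eqVlt; apply/negP => /orP[/eqP e|lt].
    by apply: nb; rewrite e.
  apply: nb; split; first exact: lam_lam.
  move=> m; apply: contrapT => H.
  have := @fin_top (lam b) m (lam a) (lam_lam b) _ lt; rewrite lam_lam => e.
  move: lt; rewrite e ?ltxx // => c lc kc; apply: H; by exists c.
have full_ne : full !=set0.
  apply: contrapT => H; apply: inf.
  have nf a : ~ full (lam a) by move=> fa; apply: H; exists (lam a).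
  have le a b : lam a = lam b.
    case: (ltgtP (lam a) (lam b)) => // lt.
      have := @fin_top (lam a) n (lam b) (lam_lam a) _ lt; rewrite lam_lam => -> //.
      move=> c lc kc.
      have [+ _] := nP _ (lam_lam a) (nf a) n; rewrite ltnn => F.
      by have : false by apply: F; exists c.
    have := @fin_top (lam b) n (lam a) (lam_lam b) _ lt; rewrite lam_lam => -> //.
    move=> c lc kc.
    have [+ _] := nP _ (lam_lam b) (nf b) n; rewrite ltnn => F.
    by have : false by apply: F; exists c.
  have kinj : {in [set: alpha] &, injective k}.
    move=> x y _ _ e; case: (ltgtP x y) => // xy;
      have := k_lt _ xy; rewrite e ltnn => /(_ (le _ _)) //.
  rewrite -(eq_finite_set (inj_card_eq kinj)).
  apply: sub_finite_set (finite_II n) => _ [x _ <-] /=.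
  by have [+ _] := nP _ (lam_lam x) (nf x) (k x); apply; exists x.
have [x0 fx0] := full_ne.
have cfull : countable [set: set_type full].
  have /countable_injP[c cinj] := cnt.
  apply/countable_injP; exists (c \o val) => x y _ _ /= e.
  by apply: val_inj; apply: cinj e; rewrite inE.
have wfull : is_ordinal (full : orderType _).
  move=> x; move: {2}(val x) (erefl (val x)) => v; elim/(well_founded_ind wf): v x.
  by move=> v IH x xv; constructor=> y yx; apply: (IH (val y)) => //; rewrite -xv.
have [psi psiP] := @admissible_exists _ (full : orderType _) cfull
  (ex_intro _ (exist _ x0 (mem_set fx0) : full) I).
exists d, (direct_sum (Omega psi) 'I_n); right.
exists d, (full : orderType _), n, psi.
suff isoA : isomorphic alpha (ord_sum (omega_times (full : orderType _)) 'I_n).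
  split=> //; first by exists (exist _ x0 (mem_set fx0) : full).
  by exists id; split=> //; exists id.
pose R a (u : ord_sum (omega_times (full : orderType _)) 'I_n) := match u with
  | inl bk => lam a = val bk.1 /\ k a = bk.2
  | inr i => ~ full (lam a) /\ k a = i
  end.
have /choice[f fR] : forall a, exists u, R a u.
  move=> a; have [fa|nfa] := pselect (full (lam a)).
    by exists (inl (exist _ (lam a) (mem_set fa) : full, k a)).
  have ka : (k a < n)%N.
    by have [+ _] := nP _ (lam_lam a) nfa (k a); apply; exists a.
  by exists (inr (Ordinal ka)).
have mono1 a b : a < b -> f a < f b.
  move=> ab; rewrite lt_neqAle; move: (fR a) (fR b).
  have lab := lam_mono (ltW ab).
  have kab := fun e => @k_lt a b e ab.
  have fullP (x : full) : full (val x) by exact: set_valP.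
  case: (f a) (f b) => [[l i]|i] [[l' i']|i'] /= [ea ka] [eb kb].
  - rewrite /Order.le /= omega_times_le /=.
    move: lab; rewrite ea eb le_eqVlt => /orP[/eqP e|lt].
      have := kab; rewrite ea eb ka kb => /(_ e) ii.
      move/val_inj: e => ->; rewrite eqxx (ltnW ii) orbT andbT.
      by apply/eqP => -[] e; move: ii; rewrite e ltnn.
    have -> : l < l' by [].
    by rewrite andbT; apply/eqP => -[e _]; move: lt; rewrite e ltxx.
  - by [].
  - have := @lam_full_lt b a; rewrite eb => /(_ (fullP _) ea).
    by rewrite -eb ltNge lab.
  - have e : lam a = lam b.
      apply: le_anti; rewrite lab /= leNgt; apply/negP => lt.
      apply: ea; split; first exact: lam_lam.
      move=> m; apply: contrapT => H.
      have := @fin_top (lam a) m (lam b) (lam_lam a) _ lt; rewrite lam_lam => e.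
      move: lt; rewrite e ?ltxx // => c lc kc; apply: H; by exists c.
    have := kab e; rewrite ka kb => ii.
    rewrite [X in _ && X](_ : _ = (i <= i')%N) // (ltnW ii) andbT.
    by apply/eqP => -[] ei; move: ii; rewrite ei ltnn.
exists f; split; last exact: le_mono.
apply: inj_surj_bij.
  move=> x y e; case: (ltgtP x y) => // /mono1; by rewrite e ltxx.
have Runiq a u v : R a u -> R a v -> u = v.
  case: u v => [[l i]|i] [[l' i']|i'] /= [ea ka] [eb kb].
  - by rewrite -ka -kb; congr (inl (_, _)); apply: val_inj; exact: etrans (esym ea) eb.
  - by exfalso; apply: eb; rewrite ea; exact: set_valP.
  - by exfalso; apply: ea; rewrite eb; exact: set_valP.
  - by congr inr; apply: val_inj; rewrite /= -ka -kb.
case=> [[l i]|i].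
  have [_ /(_ i)[a [la ka]]] : full (val l) by exact: set_valP.
  by exists a; apply: Runiq (fR a) _.
have [l [ll nl]] := n0 (leq_ltn_trans (leq0n i) (ltn_ord i)).
have [_ /(_ (ltn_ord i))[a [la ka]]] := nP l ll nl i.
by exists a; apply: Runiq (fR a) _; rewrite /= la.
Qed.

End Decomposition.

End ExistenceOfS.

(* Main.v *)
Require Import Defs.
From mathcomp Require Import all_boot all_order all_classical.
From mathcomp Require Import finmap.
Set Implicit Arguments.
Unset Strict Implicit.
Unset Printing Implicit Defensive.
Import Order.TTheory Defs.
Local Open Scope order_scope.
Local Open Scope classical_set_scope.

(** Ideals of a join-subsemilattice A of [omega]^{<omega} are determined by
    their unions, so a chain of type I(alpha) in J(A) provides, for each x in
    alpha, a finite set c_x in A and a number a_x in c_x lying in no c_y with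
    y < x.  The order of S_alpha is the intersection of its order as a chain of
    type alpha with an order of type at most omega, given by a rank.  Going
    through S_alpha by increasing rank, one picks for each s a position p(s) in
    alpha (moving up inside the component omega.{beta} of s, so that all but
    finitely many choices are good) such that a_{p(s)} avoids c_{p(t)} for all t
    of smaller rank; then a_{p(s)} is in c_{p(t)} only if s <= t, and
    X |-> 0_A u U_{s in X} c_{p(s)} is the required join-embedding. *)

(** * Inclusion orders, joins and join-embeddings *)

Definition element (T : Type) (A : set T) (x : T) (Ax : A x) : A :=
  exist _ x (mem_set Ax).

Lemma set_leP (T : Type) (A : set (set T)) (x y : A) :
  reflect (val x `<=` val y) (x <= y).
Proof. by rewrite leEsub; exact: subsetPset. Qed.

Lemma fin_leP (A : set (fin_subsets nat)) (x y : A) :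
  reflect (val (val x) `<=` val (val y)) (x <= y).
Proof. by rewrite !leEsub; exact: subsetPset. Qed.

Lemma supremums2P (d : Order.disp_t) (P : porderType d) (x y z : P) :
  supremums [set x; y] z <->
  [/\ x <= z, y <= z & forall w, x <= w -> y <= w -> z <= w].
Proof.
split=> [[ub lb]|[xz yz H]].
  split; [by apply: ub; left|by apply: ub; right|].
  by move=> w xw yw; apply: lb => _ [->|->].
split; first by move=> _ [->|->].
by move=> w uw; apply: H; apply: uw; [left|right].
Qed.

(** Joins are unique, so the range of [f] is join-closed: any supremum of two values is the one
    supplied by the second hypothesis. *)
Lemma join_embeds_morphism (d d' : Order.disp_t) (P : porderType d)
    (P' : porderType d') (f : P -> P') :
  {mono f : x y / x <= y} ->
  (forall x y, exists z, supremums [set f x; f y] (f z)) -> join_embeds P P'.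
Proof.
move=> fm fj; exists (range f); split.
  move=> _ _ z [x _ <-] [y _ <-] hz; have [w hw] := fj x y.
  by exists w => //; apply: is_subset1_supremums hw hz.
exists (fun x => element (imageT f x)); split.
  apply: ExistenceOfS.inj_surj_bij.
    by move=> x y [] /(inc_inj fm).
  case=> y hy; have [x _ fx] := set_mem hy.
  by exists x; apply: val_inj.
by move=> x y; rewrite leEsub /= fm.
Qed.

(** Course-of-values recursion: as [R m] reads [h] only below [m], a finite table of the earlier
    values suffices. *)
Lemma strong_dependent_choice (V : Type) (v0 : V)
    (R : nat -> (nat -> V) -> V -> Prop) :
  (forall m h h' v, (forall i, (i < m)%N -> h i = h' i) ->
     R m h v -> R m h' v) ->
  (forall m h, exists v, R m h v) -> exists K, forall m, R m K (K m).
Proof.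
move=> Rext Rex.
have /choice[f fP] : forall m, exists fm, forall h, R m h (fm h).
  by move=> m; have /choice[g gP] := Rex m; exists g.
(* [tab m] lists the values at 0, ..., m-1; past its end [nth] returns [v0], which the first
   hypothesis makes irrelevant. *)
pose tab := fix tab m := if m is m'.+1
  then rcons (tab m') (f m' (nth v0 (tab m'))) else [::].
have tab_size m : size (tab m) = m by elim: m => //= m IH; rewrite size_rcons IH.
have tab_nth i m : (i < m)%N -> nth v0 (tab m) i = f i (nth v0 (tab i)).
  elim: m => //= m IH; rewrite ltnS leq_eqVlt nth_rcons tab_size.
  by case/predU1P=> [->|im]; rewrite ?ltnn ?eqxx // im IH.
exists (fun i => f i (nth v0 (tab i))) => m; apply: Rext (fP m _).
by move=> i /tab_nth.
Qed.

(** * Finitely generated initial segments *)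

Section FinitelyGenerated.
Context {d : Order.disp_t} (S : porderType d).

Lemma fg_initial (X : set S) : fg_initials S X -> initial X.
Proof.
by case=> F _ -> x y [z Fz yz] xy; exists z => //; exact: le_trans yz.
Qed.

Lemma fg_initials0 : fg_initials S set0.
Proof. by exists set0 => //; rewrite predeqE => x; split=> // -[]. Qed.

Lemma fg_initials_principal (s : S) : fg_initials S [set x | x <= s].
Proof.
exists [set s] => //; rewrite predeqE => x; split=> [xs|[_ -> //]].
by exists s.
Qed.

Lemma fg_initialsU (X Y : set S) :
  fg_initials S X -> fg_initials S Y -> fg_initials S (X `|` Y).
Proof.
move=> [F finF ->] [G finG ->]; exists (F `|` G); first by rewrite finite_setU.
rewrite predeqE => x; split=> [[[y Fy]|[y Gy]] xy|[y [Fy|Gy] xy]].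
- by exists y => //; left.
- by exists y => //; right.
- by left; exists y.
- by right; exists y.
Qed.

Lemma fg_initials_join (X Y : fg_initials S) :
  exists Z : fg_initials S, val Z = val X `|` val Y /\ supremums [set X; Y] Z.
Proof.
exists (element (fg_initialsU (set_valP X) (set_valP Y))).
split=> //; apply/supremums2P; split.
- by apply/set_leP; left.
- by apply/set_leP; right.
- by move=> W /set_leP XW /set_leP YW; apply/set_leP => x [/XW|/YW].
Qed.

Lemma fg_initials_bounded : bounded_join_semilattice (fg_initials S).
Proof.
split=> [X Y|]; first by have [Z [_]] := fg_initials_join X Y; exists Z.
exists (element fg_initials0) => X.
by apply/set_leP => x [].
Qed.

(** [r] maps the elements below a generator [y] injectively into the numbers up to [r y]. *)
Lemma fg_initials_finite (r : S -> nat) (X : set S) : injective r ->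
  {homo r : x y / x <= y >-> (x <= y)%N} -> fg_initials S X -> finite_set X.
Proof.
move=> rinj rmono [F finF ->].
apply: sub_finite_set (_ : _ `<=`
    \bigcup_(y in F) (r @^-1` [set m | (m < (r y).+1)%N])) _.
  by move=> x [y Fy xy]; exists y => //=; rewrite ltnS; exact: rmono.
apply: bigcup_finite => // y _; apply: finite_preimage; last exact: finite_II.
by move=> u v _ _; apply: rinj.
Qed.

End FinitelyGenerated.

(** * Join-subsemilattices of finite subsets of [nat] and their ideals *)

Section FiniteSubsets.
Context (A : set (fin_subsets nat)) (hA : join_closed A).

(** The union is the join among all finite sets, so [hA] keeps it in [A], where it remains the
    join. *)
Lemma fin_join (F G : A) :
  exists H : A,
    val (val H) = val (val F) `|` val (val G) /\ supremums [set F; G] H.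
Proof.
have finU : finite_set (val (val F) `|` val (val G)).
  by rewrite finite_setU; split; exact: (set_valP (val _)).
pose U : fin_subsets nat := element finU.
have AU : A U.
  apply: (hA (set_valP F) (set_valP G)); apply/supremums2P; split.
  - by apply/set_leP; left.
  - by apply/set_leP; right.
  - by move=> W /set_leP FW /set_leP GW; apply/set_leP => x [/FW|/GW].
exists (element AU); split=> //; apply/supremums2P; split.
- by apply/fin_leP; left.
- by apply/fin_leP; right.
- by move=> W /fin_leP FW /fin_leP GW; apply/fin_leP => x [/FW|/GW].
Qed.

Lemma fin_big_join (T : choiceType) (c : T -> A) (b : A) (X : set T) :
  finite_set X -> exists H : A, val (val H) =
    val (val b) `|` [set m | exists2 t, X t & val (val (c t)) m].
Proof.
move=> /finite_seqP[s ->]; elim: s => [|t s [H HE]].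
  by exists b; rewrite predeqE => m; split=> [|[//|[] //]]; left.
have [G [GE _]] := fin_join (c t) H; exists G.
rewrite GE HE predeqE => m; split=> /=.
  case=> [ctm|[bm|[u us cum]]]; [|by left|].
    by right; exists t => //; rewrite inE eqxx.
  by right; exists u => //; rewrite inE us orbT.
case=> [bm|[u]]; first by right; left.
by rewrite inE => /predU1P[-> ctm|us cum]; [left|right; right; exists u].
Qed.

(** Directedness merges finitely many members. Hence a set of [A] inside the union of an ideal lies
    in one of its members, so belongs to the ideal. *)
Lemma ideal_covers_finite (X : set A) (B : set nat) : ideals A X ->
  finite_set B -> (forall m, B m -> exists2 F, X F & val (val F) m) ->
  exists2 F, X F & B `<=` val (val F).
Proof.
move=> [[F0 XF0] dirX _] /finite_seqP[s ->]; elim: s => [|m s IH] H.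
  by exists F0.
have [F XF Fs] : exists2 F, X F & [set` s] `<=` val (val F).
  by apply: IH => i /= si; apply: H; rewrite /= inE si orbT.
have [|G XG Gm] := H m; first by rewrite /= inE eqxx.
have [K [XK /fin_leP FK /fin_leP GK]] := dirX _ _ XF XG.
exists K => // i /=; rewrite inE => /predU1P[->|/Fs/FK //]; exact: GK.
Qed.

(* Each step of the chain of ideals indexed by the initial segments
   [< x] and [<= x] contributes a new point [a x]. *)
Lemma separating_points (d : Order.disp_t) (alpha : orderType d) :
  order_embeds (initials alpha) (ideals A) ->
  exists (a : alpha -> nat) (c : alpha -> A),
    [/\ forall x, val (val (c x)) (a x),
        forall x y, y < x -> ~ val (val (c y)) (a x) &
        forall x (b : A), (forall y, b <= y) -> ~ val (val b) (a x)].
Proof.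
move=> [h hm].
have ilt (x : alpha) : initials alpha [set y | y < x].
  by move=> y z /= zx yz; exact: le_lt_trans zx.
have ile (x : alpha) : initials alpha [set y | y <= x].
  by move=> y z /= zx yz; exact: le_trans zx.
pose lt_ x : initials alpha := element (ilt x).
pose le_ x : initials alpha := element (ile x).
have lt_le x y : y < x -> val (h (le_ y)) `<=` val (h (lt_ x)).
  move=> yx; apply/set_leP; rewrite hm; apply/set_leP => z /= zy.
  exact: le_lt_trans yx.
have H x : exists p : nat * A, [/\ val (val p.2) p.1, val (h (le_ x)) p.2 &
    forall F, val (h (lt_ x)) F -> ~ val (val F) p.1].
  have [c cle cnlt] : exists2 c, val (h (le_ x)) c & ~ val (h (lt_ x)) c.
    apply: contrapT => nc; have : le_ x <= lt_ x.
      rewrite -hm; apply/set_leP => c cle; apply: contrapT => cnlt.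
      by apply: nc; exists c.
    by move=> /set_leP/(_ x); rewrite /= ltxx lexx => /(_ isT).
  (* Otherwise each point of [c] lies in some member of the ideal of [lt_ x]; then a single member
     contains [c], and [c] is in the ideal. *)
  apply: contrapT => np; have ideal_lt := set_valP (h (lt_ x)).
  have [|m cm|F ltF cF] := @ideal_covers_finite _ (val (val c)) ideal_lt.
  - exact: (set_valP (val c)).
  - apply: contrapT => nF; apply: np; exists (m, c); split=> //= F ltF Fm.
    by apply: nF; exists F.
  - have [_ _ init] := ideal_lt.
    by apply: cnlt; apply: init ltF _; apply/fin_leP.
have /choice[p pP] := H.
exists (fst \o p), (snd \o p); split=> [x|x y yx|x b bmin] /=.
- by have [] := pP x.
- have [_ cy _] := pP y; have [_ _] := pP x; apply.
  exact: lt_le yx _ cy.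
- have [_ _] := pP x; apply.
  have [[F ltF] _ init] := set_valP (h (lt_ x)).
  exact: init ltF (bmin F).
Qed.

End FiniteSubsets.

(* The features of S_alpha that the proof uses: a rank [r] and a position [L]
   in the chain alpha, both monotone, and for each [s] a sequence [e s] of
   positions at which the point separating [s] may be chosen.  For
   [s = (b, i)] in Omega, [e s] enumerates the component of [s] in the chain;
   for [s] in the finite part, [e s] is constant. *)
Record layout (d d' : Order.disp_t) (alpha : orderType d) (S : porderType d')
    (r : S -> nat) (L : S -> alpha) (e : S -> nat -> alpha) : Prop := Layout {
  rank_inj : injective r;
  rank_mono : {homo r : x y / x <= y >-> (x <= y)%N};
  pos_mono : {homo L : x y / x <= y};
  pos_surj : forall x, exists s, L s = x;
  option_lt : forall s t k k',
    (r t < r s)%N -> ~~ (t <= s) -> e s k < e t k';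
  option_free : forall s, injective (e s) \/
    forall t k k', (r t < r s)%N -> e t k < e s k' }.

(** * Layouts of S_alpha for finite and infinite alpha *)

Section Layout.
Context (d d' : Order.disp_t) (alpha : orderType d) (S : porderType d').

Lemma layout_finite : finite_set [set: alpha] -> isomorphic S alpha ->
  exists r L e, @layout _ _ alpha S r L e.
Proof.
move=> fin [f [[g fK gK] fm]].
have finlt x : finite_set [set y : alpha | y < x] by exact: sub_finite_set fin.
pose rk x := #|` fset_set [set y : alpha | y < x]|.
have rk_lt x y : x < y -> (rk x < rk y)%N.
  move=> xy; apply: fproper_ltn_card; rewrite fproperE; apply/andP; split.
    by rewrite -fset_set_sub // => z /= /lt_trans; apply.
  apply/fsubsetPn; exists x; first by rewrite in_fset_set //; exact: mem_set.
  by rewrite in_fset_set //; apply/negP => /set_mem /=; rewrite ltxx.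
have rk_le x y : (rk x <= rk y)%N = (x <= y).
  case: (ltgtP x y) => [/rk_lt/ltnW -> //|/rk_lt|->]; last exact: leqnn.
  by rewrite ltnNge => /negbTE.
exists (rk \o f), f, (fun s _ => f s); split=> /=.
- move=> x y /= E; apply: (can_inj fK).
  by case: (ltgtP (f x) (f y)) => // /rk_lt; rewrite E ltnn.
- by move=> x y xy; rewrite rk_le fm.
- by move=> x y; rewrite fm.
- by move=> x; exists (g x).
- by move=> s t _ _ _; rewrite -fm -ltNge.
- by move=> s; right=> t _ _; rewrite ltnNge rk_le ltNge.
Qed.

(** The finite chain is ranked first but positioned last in alpha; this opposition reflects the
    incomparability of the two summands. *)
Lemma layout_infinite (d1 : Order.disp_t) (beta : orderType d1) (n : nat)
    (psi : omega_times beta -> nat) :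
  isomorphic alpha (ord_sum (omega_times beta) 'I_n) -> admissible psi ->
  isomorphic S (direct_sum (Omega psi) 'I_n) ->
  exists r L e, @layout _ _ alpha S r L e.
Proof.
move=> [g [[g' gK g'K] gm]] [psi_bij psi_mono] [f [[f' fK f'K] fm]].
have g'm u v : (g' u <= g' v) = (u <= v) by rewrite -gm !g'K.
have g'lt u v : u != v -> u <= v -> g' u < g' v.
  by move=> uv le; rewrite lt_neqAle g'm le (can_eq g'K) uv.
pose rank (u : direct_sum (Omega psi) 'I_n) : nat :=
  match u with inl x => (n + psi x)%N | inr i => i end.
(* The identity map: only the order changes, to that of the ordinal sum. *)
pose pos (u : direct_sum (Omega psi) 'I_n) :
  ord_sum (omega_times beta) 'I_n := u.
pose opt (u : direct_sum (Omega psi) 'I_n) k :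
  ord_sum (omega_times beta) 'I_n :=
  match u with inl x => inl (x.1, k) | inr i => inr i end.
exists (rank \o f), (fun s => g' (pos (f s))), (fun s k => g' (opt (f s) k)).
split=> /=.
- apply: inj_comp (can_inj fK) => -[x|i] [y|j] //=.
  + by move/addnI/(bij_inj psi_bij) ->.
  + by move=> E; have := ltn_ord j; rewrite -E ltnNge leq_addr.
  + by move=> E; have := ltn_ord i; rewrite E ltnNge leq_addr.
  + by move/val_inj ->.
- move=> x y; rewrite -fm /=; case: (f x) (f y) => [u|i] [v|j] //=.
  by move=> /andP[_]; rewrite leq_add2l.
- move=> x y; rewrite -fm g'm /=; case: (f x) (f y) => [u|i] [v|j] //=.
  by move=> /andP[].
- by move=> x; exists (f' (g x)); rewrite f'K gK.
- move=> s t k k'; rewrite -fm /=; case: (f s) (f t) => [u|i] [v|j] //=.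
  + rewrite ltn_add2l => vu nvu.
    (* As [v] has the smaller [psi], incomparability puts [u] before [v] in the chain, and
       monotonicity of [psi] on components excludes a common component. So the options compare
       whatever their indices. *)
    have nle : ~~ ((v : omega_times beta) <= u).
      by apply: contra nvu => vu'; apply/andP; split=> //; exact: ltnW.
    have uv1 : u.1 < v.1.
      move: nle; rewrite -ltNge lt_neqAle ExistenceOfS.omega_times_le.
      move=> /andP[_ /orP[//|/andP[/eqP E1 E2]]].
      move: vu; rewrite ltnNge; case: u v E1 E2 {nvu} => [b p] [b' q] /= <-.
      by move=> pq; rewrite -leEnat psi_mono.
    apply: g'lt; first by apply/eqP => -[E _]; rewrite E ltxx in uv1.
    by rewrite /Order.le /= ExistenceOfS.omega_times_le /= uv1.
  + by move=> _ _; apply: g'lt.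
  + by move=> /ltn_trans/(_ (ltn_ord i)); rewrite ltnNge leq_addr.
  + by move=> ji /negP[]; exact: ltnW.
- move=> s; case: (f s) => [u|i].
    by left=> k k' /(can_inj g'K) [].
  right=> t k k'; case: (f t) => [v|j] /=.
    by move=> _; apply: g'lt.
  move=> ji; apply: g'lt; last exact: ltnW.
  by apply/eqP => -[E]; rewrite E ltnn in ji.
Qed.

Lemma is_S_layout : is_S alpha S -> exists r L e, @layout _ _ alpha S r L e.
Proof.
case=> [[fin iso]|[d1 [beta [n [psi [_ _ iso adm isoS]]]]]].
  exact: layout_finite.
exact: layout_infinite iso adm isoS.
Qed.

(** * Membership in J_alpha and embedding into the finite sets *)

Context (r : S -> nat) (L : S -> alpha) (e : S -> nat -> alpha).
Context (lay : layout r L e).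

(** [I] goes to the ideal of those [X] with all positions in [I]; principal initial segments recover
    [I] from it. *)
Lemma fg_initials_in_J : in_J alpha (fg_initials S).
Proof.
split; first exact: fg_initials_bounded.
have idl (I : initials alpha) :
    ideals (fg_initials S) [set X | forall s, val X s -> val I (L s)].
  split.
  - by exists (element (fg_initials0 S)) => s [].
  - move=> X Y XI YI; have [Z [ZE /supremums2P[XZ YZ _]]] := fg_initials_join X Y.
    by exists Z; split=> // s; rewrite ZE => -[/XI|/YI].
  - by move=> X Y YI /set_leP XY s /XY/YI.
exists (fun I => element (idl I)) => I I'; apply/set_leP/set_leP => /= II'.
  move=> x Ix; have [s sx] := pos_surj lay x.
  have := II' (element (fg_initials_principal s)); rewrite -sx; apply=> //=.
  move=> t ts; apply: (set_valP I) _ (pos_mono lay ts).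
  by rewrite sx.
by move=> X XI s /XI/II'.
Qed.

(** Taking images under the injective rank preserves unions and reflects inclusion. *)
Lemma fg_initials_join_embeds_fin :
  join_embeds (fg_initials S) (fin_subsets nat).
Proof.
have finr (X : fg_initials S) : fin_subsets nat (r @` val X).
  apply: finite_image.
  exact: fg_initials_finite (rank_inj lay) (rank_mono lay) (set_valP X).
apply: (@join_embeds_morphism _ _ _ _ (fun X => element (finr X))).
  move=> X Y; apply/set_leP/set_leP => /= XY; last exact: image_subset.
  move=> s Xs; have [t Yt /(rank_inj lay) <- //] := XY _ (imageP r Xs).
move=> X Y; have [Z [ZE _]] := fg_initials_join X Y; exists Z.
apply/supremums2P; split=> [||W /set_leP/= XW /set_leP/= YW]; apply/set_leP => /=;
  rewrite ZE image_setU.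
- by left.
- by right.
- by move=> m [/XW|/YW].
Qed.

(** * Minimality, from separating points *)

Section Minimality.
Context (A : set (fin_subsets nat)) (hA : join_closed A).
Context (a : alpha -> nat) (c : alpha -> A).
Context (ac : forall x, val (val (c x)) (a x)).
Context (ac_lt : forall x y, y < x -> ~ val (val (c y)) (a x)).

Lemma separating_inj : injective a.
Proof.
move=> x y axy; case: (ltgtP x y) => // /ac_lt H; exfalso; apply: H.
  by rewrite -axy; exact: ac.
by rewrite axy; exact: ac.
Qed.

(* By recursion on the rank: if [e s] is injective, all but finitely many
   options avoid the finitely many finite sets chosen before. *)
Lemma separating_choice : exists k : S -> nat,
  forall s t, val (val (c (e t (k t)))) (a (e s (k s))) -> s <= t.
Proof.
have [K KP] : exists K : nat -> nat, forall m, forall s t,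
    r s = m -> injective (e s) -> (r t < m)%N ->
    ~ val (val (c (e t (K (r t))))) (a (e s (K m))).
  apply: (@strong_dependent_choice _ 0%N (fun m h v => forall s t,
    r s = m -> injective (e s) -> (r t < m)%N ->
    ~ val (val (c (e t (h (r t))))) (a (e s v)))).
    by move=> m h h' v hh' H s t sm es tm; rewrite -hh' //; exact: H.
  move=> m h.
  have [[s [sm es]]|ns] := pselect (exists s, r s = m /\ injective (e s)).
    pose B := \bigcup_(t in r @^-1` [set i | (i < m)%N])
                val (val (c (e t (h (r t))))).
    have finB : finite_set B.
      apply: bigcup_finite => [|t _]; last exact: (set_valP (val _)).
      by apply: finite_preimage (finite_II m) => u v _ _; exact: (rank_inj lay).
    have finP : finite_set ((a \o e s) @^-1` B).
      by apply: finite_preimage finB => u v _ _ /separating_inj/es.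
    have [v vB] : exists v, ~ ((a \o e s) @^-1` B) v.
      apply: contrapT => nv; apply: infinite_nat.
      apply: sub_finite_set finP => v _; apply: contrapT => vB.
      by apply: nv; exists v.
    exists v => s' t s'm _ tm ct; apply: vB; exists t => //=.
    by have <- : s' = s by apply: (rank_inj lay); rewrite sm.
  by exists 0%N => s t sm es; exfalso; apply: ns; exists s.
exists (K \o r) => s t /= H; apply: contrapT => /negP nst.
(* If [t] ranks lower, either the choice for [s] avoided its set or its options all precede those of
   [s]; if [s] ranks lower, [option_lt] puts the option of [t] first. *)
have [ts|st|E] := ltngtP (r t) (r s).
- have [es|es] := option_free lay s; first exact: KP ts H.
  exact: ac_lt (es _ _ _ ts) H.
- exact: ac_lt (option_lt lay _ _ st nst) H.
- by move: nst; rewrite (rank_inj lay E) lexx.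
Qed.

(** [b] is the image of the empty segment; as it contains no [a x], adding it to every image does
    not spoil the reflection of the order. *)
Lemma fg_initials_join_embeds_separated (b : A) :
  (forall x, ~ val (val b) (a x)) -> join_embeds (fg_initials S) A.
Proof.
move=> ba; have [k kP] := separating_choice.
have /choice[phi phiE] : forall X : fg_initials S, exists H : A, val (val H) =
    val (val b) `|` [set m | exists2 s, val X s & val (val (c (e s (k s)))) m].
  move=> X; apply: fin_big_join => //.
  exact: fg_initials_finite (rank_inj lay) (rank_mono lay) (set_valP X).
apply: (@join_embeds_morphism _ _ _ _ phi).
  move=> X Y; apply/fin_leP/set_leP; rewrite !phiE => XY.
    move=> s Xs; have [|/ba //|[t Yt /kP st]] := XY (a (e s (k s))).
      by right; exists s.
    exact: (fg_initial (set_valP Y) Yt st).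
  by move=> m [bm|[s /XY Ys cm]]; [left|right; exists s].
move=> X Y; have [Z [ZE _]] := fg_initials_join X Y; exists Z.
apply/supremums2P; split=> [||W /fin_leP + /fin_leP]; try apply/fin_leP;
  rewrite !phiE ?ZE.
- by move=> m [bm|[s Xs cm]]; [left|right; exists s => //; left].
- by move=> m [bm|[s Ys cm]]; [left|right; exists s => //; right].
- move=> XW YW; apply/fin_leP; rewrite phiE ZE => m [bm|[s [Xs|Ys] cm]].
  + by apply: XW; left.
  + by apply: XW; right; exists s.
  + by apply: YW; right; exists s.
Qed.

End Minimality.

Lemma fg_initials_least (A : set (fin_subsets nat)) :
  join_closed A -> in_J alpha A -> join_embeds (fg_initials S) A.
Proof.
move=> hA [[_ [b bmin]] /separating_points[a [c [ac ac_lt ba]]]].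
apply: (fg_initials_join_embeds_separated hA ac ac_lt (b := b)) => x.
exact: ba.
Qed.

End Layout.

Theorem mainTheorem5 (d : Order.disp_t) (alpha : orderType d)
    (hwo : is_ordinal alpha) (hcount : countable [set: alpha])
    (d' : Order.disp_t) (S : porderType d') (hS : is_S alpha S) :
  [/\ join_embeds (fg_initials S) (fin_subsets nat),
      in_J alpha (fg_initials S) &
      forall A : set (fin_subsets nat),
        join_closed A -> in_J alpha A -> join_embeds (fg_initials S) A].
Proof.
have [r [L [e lay]]] := is_S_layout hS.
split; [exact: fg_initials_join_embeds_fin lay|exact: fg_initials_in_J lay|].
by move=> A; exact: fg_initials_least lay _.
Qed.
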